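(* Let $k \ge 2$. For every integer $n$, $$|S_n(123,\ 132,\ (k-1)(k-2)\ldots 1\,k)| = F_{k-1,n+1}.$$ Moreover, the generating function $f(x) = \sum_{n=0}^\infty |S_n(123, 132, (k-1)(k-2)\ldots 1\, k)|\, x^n$ is given by $$f(x) = \frac{1}{1 - x - x^2 - \cdots - x^{k-1}}.$$
   Context: Permutations of $[n]=\{1,\dots,n\}$ are written in one-line notation, and $S_n$ denotes the set of them. A permutation $\pi\in S_n$ contains $\sigma\in S_m$ if there are indices $i_1<\dots<i_m$ such that for all $a,b$, $\pi(i_a)<\pi(i_b)$ iff $\sigma(a)<\sigma(b)$; otherwise $\pi$ avoids $\sigma$. For a set $R$ of permutations, $S_n(R)$ is the set of $\pi\in S_n$ avoiding every element of $R$. By convention $S_0(R)$ consists of the empty permutation only, and $S_n(R)=\emptyset$ for $n<0$. The permutation $(k-1)(k-2)\ldots 1\,k \in S_k$ lists $k-1,k-2,\dots,1$ in decreasing order followed by $k$. For $k\ge 1$ the $k$-generalized Fibonacci numbers are defined by $F_{k,n}=0$ for $n\le 0$, $F_{k,1}=1$, and $F_{k,n}=\sum_{i=1}^k F_{k,n-i}$ for $n\ge 2$. *)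

(* Defs.v *)
From HB Require Import structures.
From mathcomp Require Import all_boot all_order all_fingroup all_algebra.
From mathcomp Require Import boolp.

Set Implicit Arguments.
Unset Strict Implicit.
Unset Printing Implicit Defensive.

Import GRing.Theory Num.Theory Order.TTheory.

Local Open Scope ring_scope.

(* Permutations of [n] are elements of 'S_n, with positions and values shifted
   from {1, .., n} to {0, .., n - 1}. *)

Definition contains (n m : nat) (p : 'S_n) (s : 'S_m) : bool :=
  [exists f : {ffun 'I_m -> 'I_n},
     [forall a : 'I_m, forall b : 'I_m, (a < b)%N ==> (f a < f b)%N] &&
     [forall a : 'I_m, forall b : 'I_m, (p (f a) < p (f b))%N == (s a < s b)%N]].

Definition pattern : Type := {m : nat & 'S_m}.

Definition Pattern (m : nat) (s : 'S_m) : pattern := existT (fun m => 'S_m) m s.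

Definition avoiders (n : nat) (R : seq pattern) : {set 'S_n} :=
  [set p : 'S_n | all (fun s : pattern => ~~ contains p (projT2 s)) R].

(* |S_n(R)| for an integer n, with S_n(R) empty when n < 0. *)
Definition card_avoiders (n : int) (R : seq pattern) : nat :=
  match n with
  | Posz m => #|avoiders m R|
  | Negz _ => 0%N
  end.

Definition one_line (n : nat) (s : 'S_n) : seq nat :=
  [seq (s i).+1 | i <- enum 'I_n].

Lemma one_lineE (n : nat) (s : 'S_n) (g : nat -> nat) :
  (forall i : 'I_n, s i = g i :> nat) -> one_line s = [seq (g i).+1 | i <- iota 0 n].
Proof.
move=> sg; rewrite /one_line -val_enum_ord -map_comp.
by apply: eq_map => i /=; rewrite sg.
Qed.

Definition perm123 : 'S_3 := 1%g.

Definition perm132 : 'S_3 := tperm (@Ordinal 3 1 isT) (@Ordinal 3 2 isT).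

Lemma one_line_perm123 : one_line perm123 = [:: 1; 2; 3]%N.
Proof. by rewrite (@one_lineE _ _ id) // => i; rewrite perm1. Qed.

Lemma one_line_perm132 : one_line perm132 = [:: 1; 3; 2]%N.
Proof.
rewrite (@one_lineE _ _ (nth 0%N [:: 0; 2; 1]%N)) // => i.
by rewrite permE; case: i => [[|[|[|i]]] Hi].
Qed.

Definition dec_then_max_fun (k i : nat) : nat :=
  if (i.+1 < k)%N then (k.-2 - i)%N else i.

Lemma dec_then_max_lt (k : nat) (i : 'I_k) : (dec_then_max_fun k i < k)%N.
Proof.
rewrite /dec_then_max_fun; case: ifP => // ik.
by case: k i ik => [|[|k]] i //= _; rewrite ltnS (leq_trans (leq_subr _ _)).
Qed.

Definition dec_then_max_ord (k : nat) (i : 'I_k) : 'I_k :=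
  Ordinal (dec_then_max_lt i).

Lemma dec_then_max_inj (k : nat) : injective (@dec_then_max_ord k).
Proof.
apply: (@can_inj _ _ _ (@dec_then_max_ord k)) => i; apply: val_inj => /=.
rewrite /dec_then_max_fun; case: (ltnP i.+1 k) => ik; last by rewrite ltnNge ik.
case: k i ik => [|[|k]] i //= ik.
by rewrite !ltnS leq_subr subKn.
Qed.

Definition dec_then_max (k : nat) : 'S_k := perm (@dec_then_max_inj k).

Lemma one_line_dec_then_max (k : nat) : (0 < k)%N ->
  one_line (dec_then_max k) = rcons (rev (iota 1 k.-1)) k.
Proof.
case: k => [|k] // _; rewrite (@one_lineE _ _ (dec_then_max_fun k.+1)); last first.
  by move=> i; rewrite permE.
rewrite -addn1 iotaD map_cat cats1 /= addn1 /dec_then_max_fun ltnn; congr rcons.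
apply: (@eq_from_nth _ 0%N); first by rewrite size_map size_rev !size_iota.
move=> i; rewrite size_map size_iota => ik.
rewrite (nth_map 0%N) ?size_iota // nth_rev ?size_iota // !nth_iota //; last first.
  by rewrite ltn_subrL /=; case: k ik.
by rewrite add0n add1n ltnS ik; case: k ik => // k _; rewrite subSS.
Qed.

(* The list [:: F_{k,n}; F_{k,n-1}; ..; F_{k,1}]. *)
Fixpoint gfibs (k n : nat) : seq nat :=
  match n with
  | 0 => [::]
  | m.+1 => (if m is 0 then 1%N else sumn (take k (gfibs k m))) :: gfibs k m
  end.

Definition gfib (k : nat) (n : int) : nat :=
  match n with
  | Posz m => head 0%N (gfibs k m)
  | Negz _ => 0%N
  end.

Lemma gfib_le0 (k : nat) (n : int) : n <= 0 -> gfib k n = 0%N.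
Proof. by case: n => [[|n]|n]. Qed.

Lemma gfib1 (k : nat) : gfib k 1 = 1%N.
Proof. by []. Qed.

Lemma nth_gfibs (k n i : nat) : nth 0%N (gfibs k n) i = gfib k (n%:Z - i%:Z).
Proof.
elim: n i => [|n IHn] [|i] //.
- by rewrite subr0.
- by rewrite -[LHS]/(nth 0%N (gfibs k n) i) IHn; congr gfib; rewrite !intS opprD addrACA subrr add0r.
Qed.

Lemma gfib_rec (k : nat) (n : int) : 2 <= n ->
  gfib k n = (\sum_(1 <= i < k.+1) gfib k (n - i%:Z)%R)%N.
Proof.
case: n => [[|[|n]]|n] // _.
rewrite -[LHS]/(sumn (take k (gfibs k n.+1))) big_add1 succnK.
transitivity (\sum_(0 <= i < k) nth 0%N (gfibs k n.+1) i)%N; last first.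
  apply: eq_bigr => i _; rewrite nth_gfibs; congr gfib.
  by rewrite [n.+2%:Z]intS [i.+1%:Z]intS opprD addrACA subrr add0r.
move: (gfibs k n.+1) => s; elim: s k => [|x s IHs] [|k].
- by rewrite big_geq.
- by rewrite big1 // => i _; rewrite nth_nil.
- by rewrite big_geq.
- by rewrite big_nat_recl //= IHs.
Qed.

(* The ring R[[x]] of formal power series. *)
Record fps (R : Type) : Type := Fps { fcoef : nat -> R }.

Lemma fpsP (R : Type) (a b : fps R) : fcoef a =1 fcoef b -> a = b.
Proof. by case: a b => [a] [b] /= /funext ->. Qed.

HB.instance Definition _ (R : Type) := gen_eqMixin (fps R).
HB.instance Definition _ (R : Type) := gen_choiceMixin (fps R).

Section FpsZmodule.
Variable R : zmodType.
Implicit Types a b c : fps R.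

Definition fps_zero : fps R := Fps (fun=> 0).
Definition fps_opp a : fps R := Fps (fun n => - fcoef a n).
Definition fps_add a b : fps R := Fps (fun n => fcoef a n + fcoef b n).

Lemma fps_addA : associative fps_add.
Proof. by move=> a b c; apply: fpsP => n; rewrite /= addrA. Qed.
Lemma fps_addC : commutative fps_add.
Proof. by move=> a b; apply: fpsP => n; rewrite /= addrC. Qed.
Lemma fps_add0 : left_id fps_zero fps_add.
Proof. by move=> a; apply: fpsP => n; rewrite /= add0r. Qed.
Lemma fps_addN : left_inverse fps_zero fps_opp fps_add.
Proof. by move=> a; apply: fpsP => n; rewrite /= addNr. Qed.

HB.instance Definition _ := GRing.isZmodule.Build (fps R)
  fps_addA fps_addC fps_add0 fps_addN.

End FpsZmodule.

Section FpsComRing.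
Variable R : comNzRingType.
Implicit Types a b c : fps R.

Definition fps_one : fps R := Fps (fun n => (n == 0%N)%:R).
Definition fps_mul a b : fps R :=
  Fps (fun n => \sum_(i < n.+1) fcoef a i * fcoef b (n - i)%N).

Definition fps_trunc (N : nat) a : {poly R} := \poly_(i < N) fcoef a i.

Lemma fcoef_mul_poly (p q : {poly R}) a b (n : nat) :
    (forall i, (i <= n)%N -> p`_i = fcoef a i) ->
    (forall i, (i <= n)%N -> q`_i = fcoef b i) ->
  fcoef (fps_mul a b) n = (p * q)`_n.
Proof.
move=> pa qb; rewrite coefM; apply: eq_bigr => i _.
by rewrite pa ?qb ?leq_subr // -ltnS.
Qed.

Lemma coef_fps_trunc (N : nat) a (i : nat) :
  (i < N)%N -> (fps_trunc N a)`_i = fcoef a i.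
Proof. by move=> iN; rewrite coef_poly iN. Qed.

Lemma fps_mulC : commutative fps_mul.
Proof.
move=> a b; apply: fpsP => n.
rewrite (@fcoef_mul_poly (fps_trunc n.+1 a) (fps_trunc n.+1 b)); last 2 first.
- by move=> i ?; rewrite coef_fps_trunc.
- by move=> i ?; rewrite coef_fps_trunc.
rewrite mulrC -(@fcoef_mul_poly _ _ b a) // => i ?.
- by rewrite coef_fps_trunc.
- by rewrite coef_fps_trunc.
Qed.

Lemma fps_mulA : associative fps_mul.
Proof.
move=> a b c; apply: fpsP => n.
have T d i : (i <= n)%N -> (fps_trunc n.+1 d)`_i = fcoef d i.
  by move=> ?; rewrite coef_fps_trunc.
have TM d e i : (i <= n)%N ->
    (fps_trunc n.+1 d * fps_trunc n.+1 e)`_i = fcoef (fps_mul d e) i.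
  by move=> le_in; symmetry; apply: fcoef_mul_poly => j le_ji;
    apply: T; apply: leq_trans le_in.
rewrite (fcoef_mul_poly (T a) (TM b c)) mulrA.
by rewrite (fcoef_mul_poly (TM a b) (T c)).
Qed.

Lemma fps_mul1 : left_id fps_one fps_mul.
Proof.
move=> a; apply: fpsP => n /=; rewrite big_ord_recl /= mul1r subn0.
by rewrite big1 ?addr0 // => i _; rewrite mul0r.
Qed.

Lemma fps_mulDl : left_distributive fps_mul +%R.
Proof.
move=> a b c; apply: fpsP => n /=; rewrite -big_split /=.
by apply: eq_bigr => i _; rewrite mulrDl.
Qed.

Lemma fps_one_neq0 : fps_one != 0.
Proof.
apply/eqP => /(congr1 (fun a => fcoef a 0%N)) /= /eqP.
by rewrite oner_eq0.
Qed.

HB.instance Definition _ := GRing.Zmodule_isComNzRing.Build (fps R)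
  fps_mulA fps_mulC fps_mul1 fps_mulDl fps_one_neq0.

End FpsComRing.

Definition fpsX (R : comNzRingType) : fps R := Fps (fun n => (n == 1%N)%:R).

Section FpsUnitRing.
Variable R : comUnitRingType.
Implicit Types a b : fps R.

(* The first n coefficients of the inverse of a, highest degree first. *)
Fixpoint fps_inv_coefs a (n : nat) : seq R :=
  match n with
  | 0 => [::]
  | m.+1 =>
      (fcoef a 0%N)^-1 *
        ((m == 0%N)%:R - \sum_(i < m) fcoef a i.+1 * (fps_inv_coefs a m)`_i)
      :: fps_inv_coefs a m
  end.

Definition fps_unit : pred (fps R) := fun a => fcoef a 0%N \is a GRing.unit.

Definition fps_inv a : fps R :=
  if fps_unit a then Fps (fun n => (fps_inv_coefs a n.+1)`_0) else a.

Lemma nth_fps_inv_coefs a (n i : nat) : (i < n)%N ->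
  (fps_inv_coefs a n)`_i = (fps_inv_coefs a (n - i.+1).+1)`_0.
Proof.
elim: n i => // n IHn [|i] lt_in; first by rewrite subSS subn0.
by rewrite subSS -IHn.
Qed.

Lemma fps_mulV : {in fps_unit, left_inverse 1 fps_inv *%R}.
Proof.
move=> a ua; rewrite mulrC; apply: fpsP => n.
rewrite /fps_inv (ifT _ _ (ua : fps_unit a)) /= big_ord_recl subn0 mulrA mulrV // mul1r.
rewrite -[RHS](subrK (\sum_(i < n) fcoef a i.+1 * (fps_inv_coefs a n)`_i)).
by congr (_ + _); apply: eq_bigr => i _; rewrite nth_fps_inv_coefs.
Qed.

Lemma fps_unitPl a b : b * a = 1 -> fps_unit a.
Proof.
move/(congr1 (fun c => fcoef c 0%N)); rewrite /= big_ord1 /= => ba1.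
by apply/unitrPr; exists (fcoef b 0%N); rewrite mulrC.
Qed.

Lemma fps_inv_out : {in [predC fps_unit], fps_inv =1 id}.
Proof. by move=> a /negbTE ua; rewrite /fps_inv (ifF _ _ (ua : fps_unit a = false)). Qed.

HB.instance Definition _ := GRing.ComNzRing_hasMulInverse.Build (fps R)
  fps_mulV fps_unitPl fps_inv_out.

End FpsUnitRing.

(* The set {123, 132, (k-1)(k-2)...1 k}. *)
Definition patterns (k : nat) : seq pattern :=
  [:: Pattern perm123; Pattern perm132; Pattern (dec_then_max k)].

Definition avoiders_gf (R : seq pattern) : fps int :=
  Fps (fun n => (card_avoiders n%:Z R)%:Z).

(* Main.v *)
Require Import Defs.
From mathcomp Require Import all_boot all_order all_fingroup all_algebra.
From mathcomp Require Import zify.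

(* If the maximum of a permutation avoiding 123 and 132 stands at position j,
   the entries before it decrease (no 123) and exceed all the entries after it
   (no 132).  So the permutation is the skew sum of (j-1)(j-2)...1 j and an
   arbitrary avoider of length n - j.  Since (k-1)(k-2)...1 k starts below its
   last letter, it cannot straddle the two summands, and it occurs in the first
   one exactly when j >= k.  Hence a_n = a_(n-1) + ... + a_(n-k+1), which is both
   the Fibonacci recurrence and the power series identity. *)

Set Implicit Arguments.
Unset Strict Implicit.
Unset Printing Implicit Defensive.

(** * Pattern containment *)

Lemma containsP (n m : nat) (p : 'S_n) (s : 'S_m) :
  reflect (exists f : 'I_m -> 'I_n,
             (forall a b : 'I_m, a < b -> f a < f b) /\
             (forall a b : 'I_m, (p (f a) < p (f b)) = (s a < s b)))
          (contains p s).
Proof.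
apply: (iffP existsP) => [[f /andP[/forallP fhomo /forallP fpat]]|].
  exists f; split => a b; first by apply/implyP; exact: (forallP (fhomo a)).
  by have /forallP/(_ b)/eqP := fpat a.
case=> f [fhomo fpat]; exists (finfun f); apply/andP; split.
  by apply/forallP=> a; apply/forallP=> b; rewrite !ffunE; apply/implyP/fhomo.
by apply/forallP=> a; apply/forallP=> b; rewrite !ffunE fpat.
Qed.

Lemma contains_leq (n m : nat) (p : 'S_n) (s : 'S_m) : contains p s -> m <= n.
Proof.
case/containsP=> f [fhomo _].
rewrite -[m]card_ord -[n]card_ord; apply: (@leq_card _ _ f) => a b fab.
apply: val_inj; case: (ltngtP a b) => // /fhomo; by rewrite fab ltnn.
Qed.

(** * Skew sums of permutations *)

Section SkewSum.
Variables a b : nat.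
Implicit Types (s : 'S_a) (q : 'S_b).

(** The values of [q] form the low block and those of [s] the high one, so they are built in
    ['I_(b + a)]; [cast_ord] brings them back to the type of the positions. *)
Definition skew_sum_fun s q (i : 'I_(a + b)) : 'I_(a + b) :=
  cast_ord (addnC b a)
    (match split i with inl x => rshift b (s x) | inr y => lshift a (q y) end).

Lemma skew_sum_fun_inj s q : injective (skew_sum_fun s q).
Proof.
move=> i j /cast_ord_inj.
case: (split_ordP i) => x ->; case: (split_ordP j) => y -> /eqP; rewrite eq_shift //.
- by move/eqP/perm_inj->.
- by move/eqP/perm_inj->.
Qed.

Definition skew_sum s q : 'S_(a + b) := perm (@skew_sum_fun_inj s q).

Lemma skew_sum_lshift s q (x : 'I_a) : skew_sum s q (lshift b x) = b + s x :> nat.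
Proof.
rewrite permE /= /skew_sum_fun.
by case: split_ordP => y /eqP; rewrite eq_shift // => /eqP->.
Qed.

Lemma skew_sum_rshift s q (y : 'I_b) : skew_sum s q (rshift a y) = q y :> nat.
Proof.
rewrite permE /= /skew_sum_fun.
by case: split_ordP => x /eqP; rewrite eq_shift // => /eqP->.
Qed.

Lemma skew_sum_inj s : injective (skew_sum s).
Proof.
move=> q q' qq'; apply/permP => y; apply: val_inj.
by rewrite /= -!(skew_sum_rshift s) qq'.
Qed.

(* The first and last letters of the pattern must fall in the same summand, as
   they form an ascent; everything in between follows. *)
Lemma contains_skew_sum (m : nat) s q (t : 'S_m.+1) : t ord0 < t ord_max ->
  contains (skew_sum s q) t = contains s t || contains q t.
Proof.
move=> t_asc; apply/idP/orP; last first.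
  case=> /containsP[f [fhomo fpat]]; apply/containsP.
    exists (lshift b \o f); split=> c d; first exact: fhomo.
    by rewrite /= !skew_sum_lshift ltn_add2l fpat.
  exists (@rshift a b \o f); split=> c d; first by rewrite /= ltn_add2l; exact: fhomo.
  by rewrite /= !skew_sum_rshift fpat.
case/containsP=> f [fhomo fpat].
have fmono (c d : 'I_m.+1) : c <= d -> f c <= f d.
  by rewrite leq_eqVlt => /orP[/eqP/val_inj->|/fhomo/ltnW].
move: (fpat ord0 ord_max); rewrite t_asc.
case: (split_ordP (f ord0)) => x0 f0; case: (split_ordP (f ord_max)) => x1 f1;
  rewrite f0 f1 ?skew_sum_lshift ?skew_sum_rshift => lt01.
- have fa c : f c < a.
    by apply: leq_ltn_trans (fmono c ord_max (leq_ord c)) _; rewrite f1 /=.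
  have fE c : f c = lshift b (Ordinal (fa c)) by exact: val_inj.
  left; apply/containsP; exists (fun c => Ordinal (fa c)); split=> c d.
    exact: fhomo.
  by rewrite -fpat -(ltn_add2l b) -!(skew_sum_lshift s q) -!fE.
- by have := ltn_ord (q x1); lia.
- by have := fmono ord0 ord_max isT; rewrite f0 f1 /=; have := ltn_ord x1; lia.
- have fa c : a <= f c.
    by apply: leq_trans (fmono ord0 c isT); rewrite f0 /= leq_addr.
  have fb c : f c - a < b by have := fa c; have := ltn_ord (f c); lia.
  have fE c : f c = rshift a (Ordinal (fb c)).
    by apply: val_inj; rewrite /= subnKC.
  right; apply/containsP; exists (fun c => Ordinal (fb c)); split=> c d.
    by move/fhomo => /=; have := fa c; lia.
  by rewrite -fpat -!(skew_sum_rshift s) -!fE.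
Qed.

End SkewSum.

(** * Structure of the avoiders of 123 and 132 *)

(** Two larger letters to the right of [x] form 123 or 132 with it, depending on their order;
    testing for both at once makes that order irrelevant. *)
Lemma avoiders_fork (n : nat) (p : 'S_n) :
  ~~ contains p perm123 && ~~ contains p perm132 <->
  (forall x y z : 'I_n, x < y -> y < z -> p x < p y -> p x < p z -> False).
Proof.
pose i0 := @Ordinal 3 0 isT; pose i1 := @Ordinal 3 1 isT; pose i2 := @Ordinal 3 2 isT.
have t0 : perm132 i0 = i0 by rewrite permE.
have t1 : perm132 i1 = i2 by rewrite permE.
have t2 : perm132 i2 = i1 by rewrite permE.
have ord3 (P : 'I_3 -> Prop) : P i0 -> P i1 -> P i2 -> forall i, P i.
  move=> P0 P1 P2 [[|[|[|//]]] Hi].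
  - by rewrite (_ : Ordinal Hi = i0) //; exact: val_inj.
  - by rewrite (_ : Ordinal Hi = i1) //; exact: val_inj.
  - by rewrite (_ : Ordinal Hi = i2) //; exact: val_inj.
split=> [/andP[no123 no132] x y z xy yz pxy pxz | nofork].
  have xz := ltn_trans xy yz.
  pose f (i : 'I_3) := nth x [:: x; y; z] i.
  have fhomo (c d : 'I_3) : c < d -> f c < f d.
    by move: c d; do 2!apply: (ord3).
  case: (ltngtP (p y) (p z)) => [pyz|pzy|].
  - case/negP: no123; apply/containsP; exists f; split => //.
    by do 2!apply: (ord3); rewrite !perm1 /f /=; lia.
  - case/negP: no132; apply/containsP; exists f; split => //.
    by do 2!apply: (ord3); rewrite ?t0 ?t1 ?t2 /f /=; lia.
  - by move=> /val_inj /perm_inj yzE; rewrite yzE ltnn in yz.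
apply/andP; split; apply/containsP => -[f [fhomo fpat]];
  apply: (nofork (f i0) (f i1) (f i2)); rewrite ?fpat ?perm1 ?t0 ?t1 ?t2 //;
  exact: fhomo.
Qed.

(** Every ascent ends at the last position, which leaves no room for [z]. *)
Lemma dec_then_max_avoids_fork (j : nat) (x y z : 'I_j) :
  x < y -> y < z -> dec_then_max j x < dec_then_max j y -> False.
Proof.
rewrite !permE /= /dec_then_max_fun => xy yz; have := ltn_ord z.
by do 2?case: ifP; lia.
Qed.

Lemma contains_dec_then_max (j k : nat) : 0 < k ->
  contains (dec_then_max j) (dec_then_max k) = (k <= j).
Proof.
move=> k0; apply/idP/idP; first exact: contains_leq.
move=> kj; apply/containsP.
(* The embedding keeps the first [k - 1] positions and sends the last one to the last one. *)
have fP (i : 'I_k) : (if i.+1 < k then i : nat else j.-1) < j.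
  by have := ltn_ord i; case: ifP; lia.
exists (fun i => Ordinal (fP i)); split => c d /=.
  by have := ltn_ord c; have := ltn_ord d; do 2?case: ifP; lia.
rewrite !permE /= /dec_then_max_fun.
have := ltn_ord c; have := ltn_ord d; do ?case: ifP; lia.
Qed.

(** Serves to recover a value from the number of entries below it. *)
Lemma card_perm_lt (n : nat) (p : 'S_n) (v : nat) : v <= n ->
  #|[set i : 'I_n | p i < v]| = v.
Proof.
move=> vn.
have -> : [set i : 'I_n | p i < v] = p @^-1: [set i : 'I_n | i < v].
  by apply/setP => i; rewrite !inE.
rewrite card_preimset; last exact: perm_inj.
rewrite -sum1_card (eq_bigl (fun i : 'I_n => i < v)); last by move=> i; rewrite inE.
by rewrite -(big_ord_widen n (fun=> 1) vn) sum1_card card_ord.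
Qed.

Lemma mem_avoiders_patterns (n k : nat) (p : 'S_n) :
  (p \in avoiders n (patterns k)) =
  ~~ contains p perm123 && ~~ contains p perm132 && ~~ contains p (dec_then_max k).
Proof. by rewrite inE /= andbT andbA. Qed.

(** As [2 <= k], all three patterns start below their last letter, so each can be tested on the two
    summands separately. *)
Lemma skew_sum_mem_avoiders (j m k : nat) (q : 'S_m) : 2 <= k ->
  (skew_sum (dec_then_max j.+1) q \in avoiders (j.+1 + m) (patterns k)) =
  (j.+1 < k) && (q \in avoiders m (patterns k)).
Proof.
case: k => [|[|k]] // _; rewrite !mem_avoiders_patterns.
rewrite !contains_skew_sum; first 1 last.
- by rewrite !permE /= /dec_then_max_fun /= ltnn; lia.
- by rewrite !permE.
- by rewrite !permE.
have /andP[/negbTE-> /negbTE->] : ~~ contains (dec_then_max j.+1) perm123 &&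
    ~~ contains (dec_then_max j.+1) perm132.
  apply/avoiders_fork => x y z xy yz pxy _; exact: dec_then_max_avoids_fork xy yz pxy.
rewrite contains_dec_then_max // !orFb negb_or -ltnNge.
by rewrite andbCA.
Qed.

Lemma skew_sum_decomposition (j m : nat) (p : 'S_(j.+1 + m)) :
    ~~ contains p perm123 && ~~ contains p perm132 ->
    p (lshift m ord_max) = j + m :> nat ->
  exists q : 'S_m, p = skew_sum (dec_then_max j.+1) q.
Proof.
move=> /avoiders_fork nofork pmax.
set x0 := lshift m ord_max in pmax.
have x0E : x0 = j :> nat by [].
have plt (y : 'I_(j.+1 + m)) : y != x0 -> p y < j + m.
  move=> yx0; have : p y <= j + m by exact: ltn_ord (p y).
  rewrite leq_eqVlt => /orP[/eqP pyE|//].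
  by case/eqP: yx0; apply: (@perm_inj _ p); apply: val_inj; rewrite /= pyE pmax.
have pinj (x y : 'I_(j.+1 + m)) : p x = p y :> nat -> x = y.
  by move=> /val_inj /perm_inj.
(* the entries below [p x] are those to its right, other than the maximum *)
have below (x : 'I_(j.+1 + m)) : x < j ->
    [set y | p y < p x] = [set y : 'I_(j.+1 + m) | x < y] :\ x0.
  move=> xj; apply/setP => y; rewrite !inE.
  have pxx0 : p x < p x0 by rewrite pmax; apply: plt; rewrite -val_eqE /=; lia.
  case: (eqVneq y x0) => [->|yx0] /=; first by lia.
  apply/idP/idP => [pyx|xy].
    rewrite ltnNge; apply/negP => yx.
    have yx' : y < x.
      rewrite ltn_neqAle yx andbT; apply/eqP => /val_inj yxE.
      by rewrite yxE ltnn in pyx.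
    apply: (nofork y x x0) => //; lia.
  rewrite ltnNge; apply/negP => pxy.
  have pxy' : p x < p y.
    rewrite ltn_neqAle pxy andbT; apply/eqP => /pinj xyE.
    by rewrite xyE ltnn in xy.
  case: (ltngtP y x0) => [yx|xy'|/val_inj yE]; last by rewrite yE eqxx in yx0.
    by apply: (nofork x y x0) => //; lia.
  by apply: (nofork x x0 y) => //; lia.
(* By [below], the value at [x] is the number of positions to its right, [j + m - x], less one for
   the maximum. *)
have pval (x : 'I_(j.+1 + m)) : x < j -> p x = m + (j.-1 - x) :> nat.
  move=> xj; have := card_perm_lt p (ltnW (ltn_ord (p x))); rewrite below // => <-.
  have cx : #|[set y : 'I_(j.+1 + m) | x < y]| = j + m - x.
    (* Positions are counted as values of the identity permutation. *)
    have -> : [set y : 'I_(j.+1 + m) | x < y] =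
        ~: [set y | (1%g : 'S_(j.+1 + m)) y < x.+1].
      by apply/setP => y; rewrite !inE perm1 -ltnNge.
    rewrite cardsCs setCK card_perm_lt // card_ord; lia.
  have := cardsD1 x0 [set y : 'I_(j.+1 + m) | x < y]; rewrite cx inE x0E xj; lia.
(* If [j > 0], the entry just before the maximum is [m], and all later entries lie below it; if
   [j = 0], it is enough that they differ from the maximum. *)
have phi (y : 'I_m) : p (rshift j.+1 y) < m.
  case: (posnP j) => [j0|jpos].
    by have := plt (rshift j.+1 y); rewrite eq_shift => /(_ isT); lia.
  have jlt : j.-1 < j.+1 + m by lia.
  pose x := Ordinal jlt.
  have xj : x < j by rewrite /=; lia.
  have : rshift j.+1 y \in [set y | p y < p x].
    by rewrite below // !inE eq_shift /=; lia.
  by rewrite inE (pval x xj) /=; lia.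
pose qf (y : 'I_m) := Ordinal (phi y).
have qf_inj : injective qf.
  by move=> y y' /(congr1 val) /= /pinj /eqP; rewrite eq_shift => /eqP.
exists (perm qf_inj); apply/permP => i; apply: val_inj => /=.
case: (split_ordP i) => x ->; last by rewrite skew_sum_rshift permE.
rewrite skew_sum_lshift permE /= /dec_then_max_fun ltnS.
case: ifP => xj /=; first by rewrite pval.
rewrite (_ : x = ord_max) ?pmax 1?addnC //; apply: val_inj => /=.
by have := ltn_ord x; lia.
Qed.

(** * Counting by the position of the maximum *)

(** Positions start at 0, so a maximum at [j] closes a first block of [j.+1] letters, and the
    avoiders counted are the injective images of the avoiders [q] under [skew_sum]. *)
Lemma card_avoiders_max_at (n k : nat) (j : 'I_n.+1) : 2 <= k ->
  #|[set p in avoiders n.+1 (patterns k) | p j == ord_max]| =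
  if j.+1 < k then #|avoiders (n - j) (patterns k)| else 0.
Proof.
move=> k2; case: j => j /= jn; pose m := n - j.
have nE : n = j + m by rewrite subnKC.
have -> : n - j = m by [].
(* With [n] replaced by [j + m], the length [n.+1] is convertible to [j.+1 + m], the length of a
   skew sum. *)
move: m nE => m nE; subst n.
have jE : lshift m (@ord_max j) = Ordinal jn by exact: val_inj.
set A := [set _ in _ | _].
have AE : A = [set p | p \in [set skew_sum (dec_then_max j.+1) q | q : 'S_m] &
                       p \in avoiders (j + m).+1 (patterns k)].
  apply/setP => p; rewrite !inE.
  apply/andP/andP => -[]; last first.
    case/imsetP=> q _ -> pA; split => //; apply/eqP/val_inj.
    have := skew_sum_lshift (dec_then_max j.+1) q ord_max.
    by rewrite jE [dec_then_max _ _]permE /= /dec_then_max_fun ltnn [m + j]addnC.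
  move=> pA pmax; split=> //; apply/imsetP.
  have [||q pE] := @skew_sum_decomposition j m p.
  - by case/and4P: pA => -> ->.
  - by rewrite jE (eqP pmax).
  by exists q.
rewrite AE; case: ifP => jk; last first.
  apply: eq_card0 => p; rewrite !inE; apply/andP => -[/imsetP[q _ ->]].
  by move: (@skew_sum_mem_avoiders j m k q k2); rewrite jk inE => ->.
rewrite -(card_imset _ (@skew_sum_inj j.+1 m (dec_then_max j.+1))).
apply: eq_card => p; rewrite inE; apply/andP/imsetP => [[/imsetP[q _ ->]]|[q qA ->]].
  by rewrite skew_sum_mem_avoiders // jk => qA; exists q.
by rewrite imset_f ?skew_sum_mem_avoiders ?jk.
Qed.

Lemma card_avoiders_rec (n k : nat) : 2 <= k ->
  #|avoiders n.+1 (patterns k)| =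
  \sum_(j < n.+1 | j.+1 < k) #|avoiders (n - j) (patterns k)|.
Proof.
move=> k2; rewrite -sum1_card.
(* [p^-1] at [ord_max] is the position of the maximum. *)
rewrite (partition_big (fun p : 'S_n.+1 => (p^-1)%g ord_max) xpredT) //=.
rewrite [RHS]big_mkcond /=; apply: eq_bigr => j _.
rewrite -card_avoiders_max_at // -sum1_card; apply: eq_bigl => p.
rewrite [in RHS]inE; congr (_ && _).
by apply/eqP/eqP => [<-|<-]; rewrite ?permKV ?permK.
Qed.

Lemma card_avoiders0 (k : nat) : 2 <= k -> #|avoiders 0 (patterns k)| = 1.
Proof.
move=> k2; rewrite (_ : avoiders 0 (patterns k) = setT).
  by rewrite cardsT card_Sn.
apply/setP => p; rewrite mem_avoiders_patterns inE -!negb_or; apply/negP.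
by do ![case/orP] => /contains_leq; lia.
Qed.

Lemma big_ord_bound_swap (R : Type) (idx : R) (op : Monoid.law idx) (a b : nat)
    (F : nat -> R) :
  \big[op/idx]_(j < a | j < b) F j = \big[op/idx]_(j < b | j < a) F j.
Proof.
wlog ab : a b / a <= b.
  by move=> sym; case: (leqP a b) => [/sym //|/ltnW /sym].
rewrite -(big_ord_widen b F ab).
by apply: eq_bigl => j; rewrite (leq_trans (ltn_ord j)).
Qed.

(** The range is now the fixed window of [k - 1] terms shared by the Fibonacci recurrence and the
    denominator. *)
Lemma card_avoiders_rec_window (n k : nat) : 2 <= k ->
  #|avoiders n.+1 (patterns k)| =
  \sum_(j < k.-1 | j < n.+1) #|avoiders (n - j) (patterns k)|.
Proof.
move=> k2; rewrite card_avoiders_rec //.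
rewrite -(big_ord_bound_swap _ n.+1 k.-1 (fun j => #|avoiders (n - j) (patterns k)|)).
by apply: eq_bigl => j; lia.
Qed.

(** * Fibonacci numbers and the generating function *)

Import GRing.Theory.
Local Open Scope ring_scope.

Lemma card_avoiders_gfib (n k : nat) : (2 <= k)%N ->
  #|avoiders n (patterns k)| = gfib k.-1 n.+1%:Z.
Proof.
move=> k2; elim/ltn_ind: n => -[|n] IHn; first by rewrite card_avoiders0.
rewrite card_avoiders_rec_window // gfib_rec; last by lia.
rewrite big_add1 big_mkord /= big_mkcond /=; apply: eq_bigr => j _.
(* Terms with [j > n] have a Fibonacci index [n + 1 - j <= 0], hence vanish. *)
case: ifP => jn; last by rewrite gfib_le0 //; lia.
by rewrite IHn; last lia; congr gfib; lia.
Qed.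

Section FpsCoef.
Variable R : comNzRingType.
Implicit Types a : fps R.

Lemma fcoefD a b n : fcoef (a + b) n = fcoef a n + fcoef b n.
Proof. by []. Qed.

Lemma fcoefN a n : fcoef (- a) n = - fcoef a n.
Proof. by []. Qed.

Lemma fcoef1 n : fcoef (1 : fps R) n = (n == 0%N)%:R.
Proof. by []. Qed.

Lemma fcoef_sum (I : Type) (r : seq I) (P : pred I) (F : I -> fps R) n :
  fcoef (\sum_(i <- r | P i) F i) n = \sum_(i <- r | P i) fcoef (F i) n.
Proof. by apply: (big_morph (fun a => fcoef a n)). Qed.

Lemma fcoefXM a n :
  fcoef (fpsX R * a) n = if n is m.+1 then fcoef a m else 0.
Proof.
case: n => [|n]; first by rewrite /= big_ord1 mul0r.
rewrite /= big_ord_recl mul0r add0r big_ord_recl mul1r subn1.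
by rewrite big1 ?addr0 // => i _; rewrite mul0r.
Qed.

Lemma fcoefXnM i a n :
  fcoef (fpsX R ^+ i * a) n = if (i <= n)%N then fcoef a (n - i) else 0.
Proof.
elim: i n => [|i IHi] n; first by rewrite mul1r subn0.
by rewrite exprS -mulrA fcoefXM; case: n => [|n] //; rewrite IHi.
Qed.

End FpsCoef.

(** In degree [n.+1] the coefficient is the difference of the two sides of the window recurrence; in
    degree 0 it is the single empty permutation. *)
Lemma avoiders_gf_mul (k : nat) : (2 <= k)%N ->
  avoiders_gf (patterns k) * (1 - \sum_(1 <= i < k) fpsX int ^+ i) = 1.
Proof.
move=> k2; rewrite mulrC mulrBl mul1r mulr_suml; apply: fpsP => n.
rewrite fcoefD fcoefN fcoef_sum fcoef1.
under eq_bigr => i _ do rewrite fcoefXnM.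
rewrite big_add1 big_mkord /=.
case: n => [|n]; first by rewrite card_avoiders0 // big1.
rewrite card_avoiders_rec_window // big_mkcond /= (big_morph Posz PoszD (erefl 0)).
apply/eqP; rewrite subr_eq0; apply/eqP/eq_bigr => j _.
by rewrite subSS ltnS; case: ifP.
Qed.

Theorem theorem3p12 (k : nat) (hk : (2 <= k)%N) :
  (forall n : int, card_avoiders n (patterns k) = gfib k.-1 (n + 1)) /\
  avoiders_gf (patterns k) = 1 / (1 - \sum_(1 <= i < k) fpsX int ^+ i).
Proof.
split=> [[n|n]|].
- by rewrite [LHS]card_avoiders_gfib //; congr gfib; lia.
(* [Negz n] is [-(n + 1)], so the Fibonacci index is [-n <= 0]. *)
- by rewrite gfib_le0 //; lia.
- have fD := avoiders_gf_mul hk.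
  (* The generating function itself is the inverse that makes the denominator a unit. *)
  have uD : 1 - \sum_(1 <= i < k) fpsX int ^+ i \is a GRing.unit.
    by apply/unitrPr; exists (avoiders_gf (patterns k)); rewrite mulrC.
  exact: canRL (mulrK uD) fD.
Qed.
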